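(* Let $k_1,k_2$ be natural numbers, $a,b,c_1,c_2\in\mathbb{C}$, $t_1,t_2$ complex variables, and $r\ge1$ an integer. Let $\theta=x\frac{\partial}{\partial x}$ and $\phi=y\frac{\partial}{\partial y}$. The discrete Appell function $\mathcal{F}^{(1)}_4$ satisfies the following difference and differential formulas: $$(\Delta_{t_1})^r\mathcal{F}^{(1)}_4(a,b;c_1,c_2;t_1,t_2,1,k_2,x,y)=\frac{(a)_r(b)_r\,x^r}{(c_1)_r}\,\mathcal{F}^{(1)}_4(a+r,b+r;c_1+r,c_2;t_1,t_2,1,k_2,x,y);$$ $$(\Delta_{t_2})^r\mathcal{F}^{(1)}_4(a,b;c_1,c_2;t_1,t_2,k_1,1,x,y)=\frac{(a)_r(b)_r\,y^r}{(c_2)_r}\,\mathcal{F}^{(1)}_4(a+r,b+r;c_1,c_2+r;t_1,t_2,k_1,1,x,y);$$ $$(\theta)^r\mathcal{F}^{(1)}_4(a,b;c_1,c_2;t_1,t_2,k_1,k_2,x,y)=\frac{(-1)^{rk_1}(a)_r(b)_r(-t_1)_{rk_1}x^r}{(c_1)_r}\,\mathcal{F}^{(1)}_4(a+r,b+r;c_1+r,c_2;t_1-rk_1,t_2,k_1,k_2,x,y);$$ $$(\phi)^r\mathcal{F}^{(1)}_4(a,b;c_1,c_2;t_1,t_2,k_1,k_2,x,y)=\frac{(-1)^{rk_2}(a)_r(b)_r(-t_2)_{rk_2}y^r}{(c_2)_r}\,\mathcal{F}^{(1)}_4(a+r,b+r;c_1,c_2+r;t_1,t_2-rk_2,k_1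,k_2,x,y).$$
   Context: For $a\in\mathbb{C}$ the shifted factorial is $(a)_0=1$ and $(a)_l=a(a+1)\cdots(a+l-1)$ for $l\ge1$. For complex $a,b,c_1,c_2,t_1,t_2$ with $\Re(c_1),\Re(c_2)\ne 0,-1,-2,\dots$ and natural numbers $k_1,k_2$, the first discrete Appell function is $$\mathcal{F}^{(1)}_4(a,b;c_1,c_2;t_1,t_2,k_1,k_2,x,y)=\sum_{m,n\ge0}\frac{(a)_{m+n}(b)_{m+n}(-1)^{mk_1}(-t_1)_{mk_1}(-1)^{nk_2}(-t_2)_{nk_2}}{(c_1)_m(c_2)_n\,m!\,n!}\,x^my^n.$$ The series is regarded as an absolutely convergent function of its last two arguments $x,y$ in the region $\sqrt{|x|}+\sqrt{|y|}<1$. The forward difference is $\Delta_tf(t)=f(t+1)-f(t)$.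
   Formalization: (θ)^r and (φ)^r are read as x^r(∂/∂x)^r and y^r(∂/∂y)^r, not r-fold composites; as composites the last two formulas fail for r≥2, e.g. k1=k2=1, t1=1, t2=0, r=2: F=1+(ab/c1)x, so θ²F=(ab/c1)x, but the right side has (-1)_2=0. For r=1 the readings agree. *)

(* Defs.v *)
From HB Require Import structures.
From mathcomp Require Import all_boot all_order all_algebra.
From mathcomp Require Import complex.
From mathcomp Require Import all_classical all_reals all_analysis.

Set Implicit Arguments.
Unset Strict Implicit.
Unset Printing Implicit Defensive.

Import Order.TTheory GRing.Theory Num.Theory numFieldNormedType.Exports.

Local Open Scope classical_set_scope.
Local Open Scope ring_scope.

(* R[i] packaged as a numClosedFieldType: MathComp-Analysis attaches topology,
   norm and derivatives to the carriers of such structures, but has no instance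
   on the bare type R[i]. *)
Definition Cplx (R : realType) : numClosedFieldType := R[i].

Section DiscreteAppell.
Context {R : realType}.
Local Notation C := (Cplx R).
Implicit Types (a b c t x y : C) (k l m n r N : nat).

Definition shifted_factorial a l : C := \prod_(i < l) (a + i%:R).

Definition appell4_coef a b c1 c2 t1 t2 k1 k2 m n : C :=
  (shifted_factorial a (m + n) * shifted_factorial b (m + n) *
   ((-1) ^+ (m * k1) * shifted_factorial (- t1) (m * k1)) *
   ((-1) ^+ (n * k2) * shifted_factorial (- t2) (n * k2))) /
  (shifted_factorial c1 m * shifted_factorial c2 n * m`!%:R * n`!%:R).

Definition appell4_term a b c1 c2 t1 t2 k1 k2 x y m n : C :=
  appell4_coef a b c1 c2 t1 t2 k1 k2 m n * x ^+ m * y ^+ n.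

(* The double series is summed along squares; when it converges absolutely this
   is its sum in any other order. *)
Definition appell4 a b c1 c2 t1 t2 k1 k2 x y : C :=
  limn (fun N => \sum_(0 <= m < N) \sum_(0 <= n < N)
                   appell4_term a b c1 c2 t1 t2 k1 k2 x y m n).

Definition appell4_region x y : Prop := sqrtC `|x| + sqrtC `|y| < 1.

(* For k1 > 0 (resp. k2 > 0) the series in x (resp. y) has radius of convergence
   0 unless a parameter makes it terminate, e.g. t1 (resp. t2) is a natural
   number, so absolute convergence is a genuine hypothesis on the parameters.
   Since `|z| lives in R[i], Re brings the moduli back to R. *)
Definition appell4_abs_cvg a b c1 c2 t1 t2 k1 k2 : Prop :=
  forall x y, appell4_region x y ->
    summable [set: nat * nat] (fun p : nat * nat =>
      (complex.Re `|appell4_term a b c1 c2 t1 t2 k1 k2 x y p.1 p.2|)%:E).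

Definition forward_diff (f : C -> C) : C -> C := fun t => f (t + 1) - f t.

Definition theta (f : C -> C) : C -> C := fun x => x * derive1 f x.

(* The power (x d/dx)^r in the sense x^r (d/dx)^r, that is
   theta (theta - 1) ... (theta - r + 1), and not the r-fold composite of theta:
   with the composite the formulas already fail at r = 2, e.g. when the series
   reduces to 1 + (a b / c1) x (k1 = k2 = 1, t1 = 1, t2 = 0). *)
Definition theta_pow r (f : C -> C) : C -> C := fun x => x ^+ r * derive1n r f x.

Lemma theta_pow1 (f : C -> C) : theta_pow 1 f = theta f.
Proof. by rewrite /theta_pow derive1n1; apply/funext => x; rewrite expr1. Qed.

Definition derivable_n r (f : C -> C) x : Prop :=
  forall j : nat, (j < r)%N -> derivable (derive1n j f) x 1.

End DiscreteAppell.

(* Main.v *)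
Require Import Defs.
From HB Require Import structures.
From mathcomp Require Import all_boot all_order all_algebra.
From mathcomp Require Import complex.
From mathcomp Require Import all_classical all_reals all_analysis.
From mathcomp Require Import ring lra.

(** For fixed parameters the Appell function is a double power series, and both
    operators act on it term by term:

    - x d/dx multiplies the coefficient of index (m, n) by m; since
      (a)_(m+1+n) = a (a+1)_(m+n), (c1)_(m+1) = c1 (c1+1)_m and
      (m+1)! = (m+1) m!, differentiating in x reproduces, up to one scalar, the
      same series with a, b, c1 raised by 1 and t1 lowered by k1
      (coef_dx_appell4);
    - for k1 = 1, (-t1-1)_m = (-t1-1) (-t1)_(m-1) and
      (-t1)_m = (-t1)_(m-1) (m-1-t1), so the difference in t1 of
      (-1)^m (-t1)_m is m (-1)^(m-1) (-t1)_(m-1); the difference of the series is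
      therefore x times the series with a, b, c1 raised by 1, up to the scalar
      a b / c1 (appell4_coef_diff).

    The formulas follow by induction on r, and those in y and t2 from the
    symmetry of the double series (appell4C).

    Convergence is assumed only for the given parameters, so the analytic work
    is to propagate it to every series that the induction meets. Two facts carry
    this: the region is open and contains a slight dilation of each of its
    points, so absolute convergence on all of it survives multiplication of the coefficients by
    weights of subexponential growth (region_convergent_weight); and the formal
    derivative converges on the same region (region_convergent_dx). The shifted
    series is the old one weighted by (a+m+n)(b+m+n)/(c1+m), or is its formal
    derivative divided by a scalar. When that scalar is 0 the shifted series may
    diverge, but then both sides of the formula vanish, so this case is treated
    apart.

    Termwise differentiation comes from a second-order Taylor estimate for
    monomials, uniform in the exponent (taylor1_bound). Absolutely bounded double
    series are summed along squares; their convergence reduces to monotone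
    bounded real sequences (cvgn_dominated), and inserting a zero row, which
    turns squares into rectangles, leaves the sum unchanged (double_sum_lag). *)

Set Implicit Arguments.
Unset Strict Implicit.
Unset Printing Implicit Defensive.

Import Order.TTheory GRing.Theory Num.Theory numFieldNormedType.Exports.

Local Open Scope classical_set_scope.
Local Open Scope ring_scope.

(** * Convergence of complex sequences *)
Section ComplexSequences.
Context {R : realType}.
Local Notation C := (Cplx R).
Implicit Types (u v : nat -> C) (A : nat -> C).

Lemma Re_subC (z w : C) : complex.Re (z - w) = complex.Re z - complex.Re w.
Proof. by case: z w => [? ?] [? ?]. Qed.

Lemma Im_subC (z w : C) : complex.Im (z - w) = complex.Im z - complex.Im w.
Proof. by case: z w => [? ?] [? ?]. Qed.

Lemma ler_Re (z w : C) : z <= w -> complex.Re z <= complex.Re w.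
Proof. by rewrite lecE => /andP[]. Qed.

Lemma normr_Re_le (z : C) : `|complex.Re z| <= complex.Re `|z|.
Proof. exact: (ler_Re (normc_ge_Re z)). Qed.

(** Multiplication by i exchanges the two parts and preserves the modulus. *)
Lemma normr_Im_le (z : C) : `|complex.Im z| <= complex.Re `|z|.
Proof.
have := normr_Re_le (z * ('i%C : C)).
by rewrite normrM (_ : `|'i%C : C| = 1) ?mulr1 ?(ReiNIm z) ?normrN // complexiE normCi.
Qed.

Lemma normC_le_ReIm (z : C) :
  `|z| <= ((`|complex.Re z| + `|complex.Im z|)%:C)%C :> C.
Proof.
have normr_real (x : R) : `|(x%:C)%C : C| = (`|x|%:C)%C.
  by rewrite [LHS]normc_def /= expr0n /= addr0 sqrtr_sqr.
rewrite [X in `|X|](complexE z) rmorphD /=.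
apply: le_trans (ler_normD _ _) _.
by rewrite normrM !normr_real (_ : `|'i%C : C| = 1) ?mul1r // complexiE normCi.
Qed.

Lemma cvgn_of_ReIm u : cvgn (fun n => complex.Re (u n)) ->
  cvgn (fun n => complex.Im (u n)) -> cvgn u.
Proof.
set re := fun n => complex.Re (u n); set im := fun n => complex.Im (u n).
move=> hp hq; suff ul : u @ \oo --> ((limn re +i* limn im)%C : C) by exact: cvgP ul.
apply/cvgrPdist_lt => e e0.
have [Ime Ree] : complex.Im e = 0 /\ 0 < complex.Re e.
  by move: e0; rewrite ltcE /= => /andP[/eqP].
have e20 : 0 < complex.Re e / 2 by rewrite divr_gt0.
move/cvgrPdist_lt : hp => /(_ _ e20) hp.
move/cvgrPdist_lt : hq => /(_ _ e20) hq.
near=> n.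
apply: le_lt_trans (normC_le_ReIm _) _.
rewrite ltcE /= Ime eqxx Re_subC Im_subC /= [ltRHS]splitr.
by apply: ltrD; near: n.
Unshelve. all: by end_near. Qed.

(** Both g and f + g are nondecreasing and bounded above, so f is a difference of
    two convergent sequences. *)
Lemma cvgn_Re_dominated (f : nat -> R) (g : nat -> R) (B : R) :
  (forall n, `|f n.+1 - f n| <= g n.+1 - g n) -> (forall n, g n <= B) ->
  `|f 0| <= g 0 ->
  cvgn f.
Proof.
move=> fg gB fg0.
have g_mono : {homo g : n m / (n <= m)%N >-> n <= m}.
  apply/nondecreasing_seqP => n; rewrite -subr_ge0.
  exact: le_trans (normr_ge0 _) (fg n).
have fgn n : f n <= g n.
  elim: n => [|n IH]; first exact: le_trans (ler_norm _) fg0.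
  rewrite -(subrK (f n) (f n.+1)) -(subrK (g n) (g n.+1)) lerD //.
  exact: le_trans (ler_norm _) (fg n).
have gc : cvgn g by apply: nondecreasing_is_cvgn => //; exists B => _ [n _ <-].
have fgc : cvgn (f \+ g).
  apply: nondecreasing_is_cvgn.
    apply/nondecreasing_seqP => n /=.
    have := fg n; rewrite ler_norml => /andP[]; rewrite opprB.
    by rewrite -subr_ge0 => h _; rewrite -subr_ge0; apply: le_trans h _; lra.
  by exists (B + B) => _ [n _ <-] /=; rewrite lerD // (le_trans (fgn n)).
rewrite (_ : f = (f \+ g) \- g); first exact: is_cvgB.
by apply/funext => n /=; rewrite addrK.
Qed.

(** Convergence of a complex series with bounded sums of moduli: u plays the
    partial sums and A the partial sums of the moduli. The bound is applied to the
    real and imaginary parts, which reduces completeness of the complex plane to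
    that of the line. *)
Lemma cvgn_dominated u A (B : C) :
  (forall n, `|u n.+1 - u n| <= A n.+1 - A n) -> (forall n, A n <= B) ->
  `|u 0%N| <= A 0%N -> cvgn u.
Proof.
move=> uA AB uA0.
apply: cvgn_of_ReIm;
  apply: (@cvgn_Re_dominated _ (fun n => complex.Re (A n)) (complex.Re B)) => [n|n|] /=.
- rewrite -!Re_subC; apply: le_trans (normr_Re_le _) _; exact: ler_Re.
- exact: ler_Re.
- by apply: le_trans (normr_Re_le _) _; exact: ler_Re.
- rewrite -Im_subC -Re_subC; apply: le_trans (normr_Im_le _) _; exact: ler_Re.
- exact: ler_Re.
- by apply: le_trans (normr_Im_le _) _; exact: ler_Re.
Qed.

Lemma norm_cvgn_le u (l B : C) : u @ \oo --> l -> (forall n, `|u n| <= B) ->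
  `|l| <= B.
Proof.
move=> ul uB.
have B0 : 0 <= B by apply: le_trans (uB 0%N).
rewrite real_leNgt ?ger0_real //; apply/negP => lB.
have e0 : 0 < `|l| - B by rewrite subr_gt0.
move/cvgrPdist_lt : ul => /(_ _ e0) [N _ /(_ N (leqnn N))] /=.
rewrite ltrBrDr => h; suff : `|l| < `|l| by rewrite ltxx.
apply: le_lt_trans h; rewrite -{1}(subrK (u N) l).
by apply: le_trans (ler_normD _ _) _; rewrite lerD2l.
Qed.

End ComplexSequences.

(** * Absolutely bounded double series summed along squares *)
Section DoubleSeries.
Context {R : realType}.
Local Notation C := (Cplx R).
Implicit Types (f g : nat -> nat -> C) (N : nat).

Definition square_sum f N : C := \sum_(0 <= m < N) \sum_(0 <= n < N) f m n.

Definition abs_bounded f : Prop :=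
  exists B : C, forall N, square_sum (fun m n => `|f m n|) N <= B.

Definition double_sum f : C := limn (square_sum f).

(** Coefficients of x times the series: the rows are moved down by one and a zero
    row is put on top. *)
Definition lag f m n : C := if m is m'.+1 then f m' n else 0.

Lemma square_sumS f N :
  square_sum f N.+1 =
  square_sum f N + (\sum_(0 <= m < N) f m N + \sum_(0 <= n < N.+1) f N n).
Proof.
rewrite /square_sum big_nat_recr //= addrA; congr (_ + _).
by rewrite -big_split /=; apply: eq_bigr => m _; rewrite big_nat_recr.
Qed.

Lemma square_sumS_sub f N :
  square_sum f N.+1 - square_sum f N =
  \sum_(0 <= m < N) f m N + \sum_(0 <= n < N.+1) f N n.
Proof. by rewrite square_sumS addrC addKr. Qed.

Lemma norm_square_sum_le f N :
  `|square_sum f N| <= square_sum (fun m n => `|f m n|) N.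
Proof.
apply: le_trans (ler_norm_sum _ _ _) _; apply: ler_sum => m _.
exact: ler_norm_sum.
Qed.

Lemma square_sum_le f g N : (forall m n, f m n <= g m n) ->
  square_sum f N <= square_sum g N.
Proof. by move=> fg; apply: ler_sum => m _; apply: ler_sum => n _. Qed.

Lemma square_sumZ (k : C) f N :
  square_sum (fun m n => k * f m n) N = k * square_sum f N.
Proof.
by rewrite /square_sum mulr_sumr; apply: eq_bigr => m _; rewrite mulr_sumr.
Qed.

Lemma square_sumD f g N :
  square_sum (fun m n => f m n + g m n) N = square_sum f N + square_sum g N.
Proof.
by rewrite /square_sum -big_split; apply: eq_bigr => m _; rewrite big_split.
Qed.

Lemma square_sum_lagS f N :
  square_sum (lag f) N.+1 = square_sum f N + \sum_(0 <= m < N) f m N.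
Proof.
rewrite /square_sum big_nat_recl //= big1 // add0r -big_split /=.
by apply: eq_bigr => m _; rewrite big_nat_recr.
Qed.

Lemma square_sum_transpose f N :
  square_sum (fun m n => f n m) N = square_sum f N.
Proof. exact: exchange_big. Qed.

(** The squares are nested, so the increment of a square sum is bounded by the
    increment of the square sum of the moduli. *)
Lemma abs_bounded_square_sum f : abs_bounded f ->
  cvgn (square_sum (fun m n => `|f m n|)) /\ cvgn (square_sum f).
Proof.
move=> [B fB].
have step g : (forall m n, `|g m n| = `|f m n|) -> cvgn (square_sum g).
  move=> gf; apply: (@cvgn_dominated _ _ (square_sum (fun m n => `|f m n|)) B).
  - move=> n; rewrite !square_sumS_sub.
    apply: le_trans (ler_normD _ _) _; apply: lerD;
      by apply: le_trans (ler_norm_sum _ _ _) _; apply: ler_sum => i _; rewrite gf.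
  - exact: fB.
  - by rewrite /square_sum !big_geq // normr0.
by split; apply: step => // m n; rewrite normr_id.
Qed.

Lemma cvgn_square_sum f : abs_bounded f -> square_sum f @ \oo --> double_sum f.
Proof. by case/abs_bounded_square_sum. Qed.

Lemma cvg_double_sum f (l : C) : square_sum f @ \oo --> l -> double_sum f = l.
Proof. by move=> fl; apply: cvg_lim. Qed.

Lemma eq_double_sum f g : (forall m n, f m n = g m n) ->
  double_sum f = double_sum g.
Proof.
by move=> fg; congr double_sum; apply/funext => m; apply/funext => n.
Qed.

Lemma abs_bounded_le (K : C) f g : 0 <= K ->
  (forall m n, `|f m n| <= K * `|g m n|) -> abs_bounded g -> abs_bounded f.
Proof.
move=> K0 fg [B gB]; exists (K * B) => N.
apply: le_trans (square_sum_le _ fg) _.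
by rewrite square_sumZ ler_wpM2l.
Qed.

Lemma abs_boundedZ (k : C) f : abs_bounded f ->
  abs_bounded (fun m n => k * f m n).
Proof. by apply: abs_bounded_le (normr_ge0 k) _ => m n; rewrite normrM. Qed.

Lemma abs_boundedD f g : abs_bounded f -> abs_bounded g ->
  abs_bounded (fun m n => f m n + g m n).
Proof.
move=> [B fB] [B' gB]; exists (B + B') => N.
apply: le_trans (lerD (fB N) (gB N)); rewrite -square_sumD.
by apply: square_sum_le => m n; exact: ler_normD.
Qed.

Lemma abs_bounded_row f : abs_bounded f -> abs_bounded (fun m n => f m.+1 n).
Proof.
move=> [B fB]; exists B => N; apply: le_trans (fB N.+1).
rewrite /square_sum [leRHS]big_nat_recl //= ler_wpDl ?sumr_ge0//.
by apply: ler_sum => m _; rewrite big_nat_recr //= ler_wpDr.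
Qed.

Lemma abs_bounded_lag f : abs_bounded f -> abs_bounded (lag f).
Proof.
move=> [B fB]; exists B => -[|N].
  by apply: le_trans (fB 0%N); rewrite /square_sum !big_geq.
apply: le_trans (fB N.+1).
rewrite (_ : (fun m n => `|lag f m n|) = lag (fun m n => `|f m n|)).
  by rewrite square_sum_lagS square_sumS lerD2l lerDl sumr_ge0.
by apply/funext => -[|m]; apply/funext => n //=; rewrite normr0.
Qed.

(** A square sum of the lagged family is a square sum of f plus the start of its
    column N, and that column lies in the increment of the convergent square sum of
    the moduli, so it tends to 0. *)
Lemma double_sum_lag f : abs_bounded f -> double_sum (lag f) = double_sum f.
Proof.
move=> fb; apply: cvg_double_sum.
rewrite -(cvg_shiftS (square_sum (lag f))).
have [Ac _] := abs_bounded_square_sum fb.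
set A := square_sum _ in Ac.
have A0 : (fun N => A N.+1 - A N) @ \oo --> (0 : C).
  rewrite -(subrr (limn A)); apply: cvgB => //.
  by rewrite (cvg_shiftS A).
have col0 : (fun N => \sum_(0 <= m < N) f m N) @ \oo --> (0 : C).
  apply/cvgrPdist_lt => e e0; move/cvgrPdist_lt : A0 => /(_ _ e0).
  apply: filterS => N; rewrite !sub0r !normrN; apply: le_lt_trans.
  rewrite /A square_sumS_sub [leRHS]ger0_norm ?addr_ge0 ?sumr_ge0//.
  by rewrite ler_wpDr ?sumr_ge0// ler_norm_sum.
rewrite -(addr0 (double_sum f)).
rewrite (eq_cvg _ _ (square_sum_lagS f)).
exact: (cvgD (cvgn_square_sum fb) col0).
Qed.

Lemma double_sumZ (k : C) f : abs_bounded f ->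
  double_sum (fun m n => k * f m n) = k * double_sum f.
Proof.
move=> fb; apply: cvg_double_sum.
rewrite (eq_cvg _ _ (square_sumZ k f)).
exact: (cvgM (cvg_cst k) (cvgn_square_sum fb)).
Qed.

Lemma double_sumD f g : abs_bounded f -> abs_bounded g ->
  double_sum (fun m n => f m n + g m n) = double_sum f + double_sum g.
Proof.
move=> fb gb; apply: cvg_double_sum.
rewrite (eq_cvg _ _ (square_sumD f g)).
exact: (cvgD (cvgn_square_sum fb) (cvgn_square_sum gb)).
Qed.

End DoubleSeries.

(** * The region of convergence *)
Section AppellRegion.
Context {R : realType}.
Local Notation C := (Cplx R).
Implicit Types (x y : C).

Lemma region_le x x' y : `|x'| <= `|x| -> appell4_region x y ->
  appell4_region x' y.
Proof.
move=> xx; apply: le_lt_trans; rewrite lerD2r.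
by rewrite ler_sqrtC ?nnegrE.
Qed.

Lemma regionC x y : appell4_region x y -> appell4_region y x.
Proof. by rewrite /appell4_region addrC. Qed.

Lemma sqrtCD_le (u v : C) : 0 <= u -> 0 <= v ->
  sqrtC (u + v) <= sqrtC u + sqrtC v.
Proof.
move=> u0 v0.
have su : 0 <= sqrtC u by rewrite sqrtC_ge0.
have sv : 0 <= sqrtC v by rewrite sqrtC_ge0.
rewrite -(@ler_pXn2r _ 2) ?nnegrE ?addr_ge0// ?sqrtC_ge0 ?addr_ge0//.
by rewrite sqrrD !sqrtCK addrAC lerDl mulrn_wge0// mulr_ge0.
Qed.

(** The square root is subadditive, so enlarging the modulus of x by d costs at most
    the square root of d; half of the room left in the inequality is spent. *)
Lemma region_enlarge x y : appell4_region x y ->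
  exists2 d : C, 0 < d & appell4_region (`|x| + d) y.
Proof.
rewrite /appell4_region; set s := _ + _ => s1.
have e0 : 0 < (1 - s) / 2 by rewrite divr_gt0 // subr_gt0.
exists (((1 - s) / 2) ^+ 2); first by rewrite exprn_gt0.
have d0 : 0 <= ((1 - s) / 2) ^+ 2 by rewrite exprn_ge0 // ltW.
rewrite ger0_norm ?addr_ge0//.
apply: (@le_lt_trans _ _ (s + (1 - s) / 2)).
  rewrite /s addrAC lerD2r; apply: le_trans (sqrtCD_le _ _) _ => //.
  by rewrite sqrCK // ltW.
by rewrite -ltrBrDl ltr_pdivrMr // mulr_natr mulr2n ltrDr subr_gt0.
Qed.

(** With s the sum of the square roots, dilating by v^2 multiplies s by v, and
    v = 2 / (1 + s) satisfies both v > 1 and v s < 1. *)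
Lemma region_dilate x y : appell4_region x y ->
  exists2 k : C, 1 < k & appell4_region (k * x) (k * y).
Proof.
rewrite /appell4_region; set s := _ + _ => s1.
have s0 : 0 <= s by rewrite addr_ge0 ?sqrtC_ge0.
have s10 : 0 < 1 + s by rewrite ltr_wpDr.
pose v := 2 / (1 + s).
have v1 : 1 < v by rewrite ltr_pdivlMr // mul1r -[2]/(1 + 1) ltrD2l.
have v0 : 0 <= v by rewrite (le_trans ler01) // ltW.
exists (v ^+ 2); first by rewrite exprn_egt1.
rewrite (normrM _ x) (normrM _ y) ger0_norm ?exprn_ge0// [sqrtC (_ * `|x|)]rootCMl ?exprn_ge0//.
rewrite [sqrtC (_ * `|y|)]rootCMl ?exprn_ge0// sqrCK //.
rewrite -mulrDr -/s /v mulrAC ltr_pdivrMr // mul1r.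
by rewrite mulr_natl mulr2n ltrD2r.
Qed.

End AppellRegion.

(** * Double power series *)
Section DoublePowerSeries.
Context {R : realType}.
Local Notation C := (Cplx R).
Implicit Types (q w : nat -> nat -> C) (x y h d : C).

Definition monomials q x y m n : C := q m n * x ^+ m * y ^+ n.

(** Convergence is required on the whole region, not at one point: its openness is
    what pays for polynomial weights and for derivatives. *)
Definition region_convergent q : Prop :=
  forall x y, appell4_region x y -> abs_bounded (monomials q x y).

Definition power_series q x y : C := double_sum (monomials q x y).

Definition subexponential w : Prop :=
  forall k : C, 1 < k -> exists2 K : C, 0 <= K &
    forall m n, `|w m n| <= K * k ^+ (m + n).

(** Coefficients of the formal derivative in x. *)
Definition coef_dx q m n : C := m.+1%:R * q m.+1 n.

(** Compare the weighted series at (x, y) with the original one at a dilated point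
    of the region, whose terms are larger by the factor k^(m+n). *)
Lemma region_convergent_weight w q : subexponential w -> region_convergent q ->
  region_convergent (fun m n => w m n * q m n).
Proof.
move=> ws qc x y xy; have [k k1 kxy] := region_dilate xy.
have [K K0 wK] := ws _ k1.
apply: (abs_bounded_le K0 _ (qc _ _ kxy)) => m n.
have k0 : 0 <= k by rewrite (le_trans ler01) // ltW.
rewrite /monomials !exprMn -!mulrA normrM.
apply: le_trans (ler_wpM2r _ (wK m n)) _ => //.
rewrite -mulrA ler_wpM2l // exprD !normrM !(ger0_norm (exprn_ge0 _ k0)).
by rewrite le_eqVlt; apply/orP; left; apply/eqP; ring.
Qed.

Lemma bernoulli_le (k : C) (l : nat) : 1 < k -> l%:R * (k - 1) <= k ^+ l.
Proof.
move=> k1; have k0 : 0 < k - 1 by rewrite subr_gt0.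
have kp n : 1 <= k ^+ n by rewrite exprn_ege1 // ltW.
elim: l => [|l IH]; first by rewrite mul0r expr0.
rewrite -natr1 mulrDl mul1r exprS.
have -> : k * k ^+ l = k ^+ l + (k - 1) * k ^+ l by ring.
by rewrite lerD // ler_peMr // ltW.
Qed.

Lemma subexponential_affine (e : C) :
  subexponential (fun m n => e + (m + n)%:R).
Proof.
move=> k k1; have k0 : 0 < k - 1 by rewrite subr_gt0.
exists (`|e| + (k - 1)^-1); first by rewrite addr_ge0 // invr_ge0 ltW.
move=> m n; apply: le_trans (ler_normD _ _) _; rewrite mulrDl normr_nat lerD //.
  by rewrite ler_peMr // exprn_ege1 // ltW.
by rewrite mulrC ler_pdivlMr // bernoulli_le.
Qed.

Lemma nat_upper_boundC (z : C) : 0 <= z -> exists M : nat, z <= M%:R.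
Proof.
rewrite lecE => /andP[/eqP Imz Rez].
exists (Num.bound (complex.Re z)).
rewrite -(rmorph_nat (real_complex R)) lecE Imz eqxx /=.
exact: ltW (archi_boundP Rez).
Qed.

(** Past twice the modulus of c the quotient has modulus at most 1; the finitely
    many earlier quotients are bounded by their sum. *)
Lemma subexponential_ratio (c : C) : (forall n : nat, c + n%:R != 0) ->
  subexponential (fun m n => c / (c + m%:R)).
Proof.
move=> c0 k k1.
have [M cM] : exists M : nat, `|c| *+ 2 <= M%:R.
  by apply: nat_upper_boundC; rewrite mulrn_wge0.
(* The sum controls the indices below M, the summand 1 the others. *)
exists (1 + \sum_(m < M) `|c / (c + m%:R)|); first by rewrite addr_ge0 // sumr_ge0.
move=> m n; apply: (@le_trans _ _ (1 + \sum_(m < M) `|c / (c + m%:R)|)); last first.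
  by rewrite ler_peMr ?addr_ge0 ?sumr_ge0// exprn_ege1 // ltW.
have [mM|Mm] := ltnP m M.
  by rewrite (bigD1 (Ordinal mM)) //= addrCA lerDl addr_ge0 // sumr_ge0.
rewrite ler_wpDr ?sumr_ge0// normrM normfV ler_pdivrMr ?normr_gt0// mul1r.
have : `|m%:R : C| <= `|c + m%:R| + `|c|.
  by rewrite -{1}(addKr c m%:R) addrC; apply: le_trans (ler_normB _ _) _.
rewrite normr_nat -lerBlDr; apply: le_trans.
by rewrite lerBrDr -mulr2n (le_trans cM) // ler_nat.
Qed.

(** The remainder is the part of the binomial expansion of order at least 2 in h.
    There |h|^j <= (|h| / d)^2 d^j for j >= 2, and the resulting sum is part of the
    expansion of (|x| + d)^m. The bound loses no factor depending on m, so it can be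
    summed against the coefficients at the point |x| + d. *)
Lemma taylor1_bound x h d (m : nat) : 0 < d -> `|h| <= d ->
  `|(x + h) ^+ m - x ^+ m - h * (m%:R * x ^+ m.-1)| * d ^+ 2 <=
  `|h| ^+ 2 * (`|x| + d) ^+ m.
Proof.
move=> d0 hd; have d0' := ltW d0.
case: m => [|[|m]].
- by rewrite !expr0 mul0r mulr0 subrr subr0 normr0 mul0r mulr1 exprn_ge0.
- rewrite [X in `|X|](_ : _ = 0); last by rewrite /=; ring.
  by rewrite normr0 mul0r mulr_ge0 ?exprn_ge0 ?addr_ge0.
have split2 (u v : C) : (u + v) ^+ m.+2 = u ^+ m.+2 + v * (m.+2%:R * u ^+ m.+1) +
    \sum_(i < m.+1) u ^+ (m - i) * v ^+ i.+2 *+ 'C(m.+2, i.+2).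
  rewrite exprDn 2!big_ord_recl /= /bump /= !add1n bin0 bin1 subn0 subn1 /=.
  rewrite expr0 expr1 mulr1 mulr1n addrA; congr (_ + _ + _).
  by rewrite -mulr_natr; ring.
rewrite [in leLHS]split2 /= [X in `|X|](_ : _ = \sum_(i < m.+1)
  x ^+ (m - i) * h ^+ i.+2 *+ 'C(m.+2, i.+2)); last by ring.
apply: (@le_trans _ _ (`|h| ^+ 2 *
    \sum_(i < m.+1) `|x| ^+ (m - i) * d ^+ i.+2 *+ 'C(m.+2, i.+2))); last first.
  rewrite ler_wpM2l ?exprn_ge0// split2 lerDr addr_ge0 ?exprn_ge0//.
  by rewrite !mulr_ge0 ?exprn_ge0.
apply: le_trans (ler_wpM2r _ (ler_norm_sum _ _ _)) _; first exact: exprn_ge0.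
rewrite mulr_suml mulr_sumr; apply: ler_sum => i _.
rewrite normrMn mulrnAl mulrnAr ler_wMn2r // normrM !normrX.
have -> : `|x| ^+ (m - i) * `|h| ^+ i.+2 * d ^+ 2 =
    `|h| ^+ 2 * (`|x| ^+ (m - i) * (`|h| ^+ i * d ^+ 2)) by rewrite !exprS; ring.
rewrite -(addn2 i) exprD !ler_wpM2l ?ler_wpM2r ?exprn_ge0//.
by rewrite lerXn2r ?nnegrE.
Qed.

Lemma deriv_monomial_bound x d (m : nat) : 0 <= d ->
  `|m%:R * x ^+ m.-1| * d <= (`|x| + d) ^+ m.
Proof.
move=> d0; elim: m => [|[|m] IH].
- by rewrite mul0r normr0 mul0r expr0.
- by rewrite mul1r expr0 normr1 mul1r expr1 lerDr.
rewrite -natr1 mulrDl mul1r exprS [leRHS]mulrDl.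
have e0 : 0 <= `|x| + d by rewrite addr_ge0.
apply: le_trans (ler_wpM2r d0 (ler_normD _ _)) _; rewrite mulrDl.
apply: lerD.
  apply: le_trans (ler_wpM2l (normr_ge0 x) IH).
  by rewrite [m.+2.-1]/= exprS mulrCA normrM mulrA.
rewrite mulrC ler_wpM2l // normrX lerXn2r ?nnegrE// lerDl//.
Qed.

(** Since m |x|^(m-1) d <= (|x| + d)^m, the derived series at x is dominated by the
    original one at the larger point |x| + d. *)
Lemma region_convergent_dx q : region_convergent q ->
  region_convergent (coef_dx q).
Proof.
move=> qc x y xy; have [d d0 dxy] := region_enlarge xy.
have := abs_bounded_row (qc _ _ dxy).
apply: (@abs_bounded_le _ d^-1); first by rewrite invr_ge0 ltW.
move=> m n; rewrite mulrC ler_pdivlMr //.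
have := deriv_monomial_bound x m.+1 (ltW d0).
move=> /(ler_wpM2r (normr_ge0 (q m.+1 n * y ^+ n))).
have e0 : 0 <= `|x| + d by rewrite addr_ge0 // ltW.
rewrite -[X in _ <= X * _]ger0_norm ?exprn_ge0// -!normrM.
rewrite /monomials /coef_dx !normrM /=; apply: etrans; congr (_ <= _); ring.
Qed.

Lemma region_convergent_lag q : region_convergent q -> region_convergent (lag q).
Proof.
move=> qc x y xy; have := abs_boundedZ x (abs_bounded_lag (qc _ _ xy)).
apply: (@abs_bounded_le _ 1) => // -[|m] n; rewrite mul1r /monomials /=.
  by rewrite !mul0r mulr0.
by rewrite exprS !mulrA [q m n * x]mulrC.
Qed.

Lemma power_series_lag q x y : region_convergent q -> appell4_region x y ->
  power_series (lag q) x y = x * power_series q x y.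
Proof.
move=> qc xy; have qb := qc _ _ xy.
rewrite /power_series -(double_sum_lag qb) -double_sumZ; last exact: abs_bounded_lag.
apply: eq_double_sum => -[|m] n; rewrite /monomials /=.
  by rewrite !mul0r mulr0.
by rewrite exprS !mulrA [q m n * x]mulrC.
Qed.

Lemma region_convergentZ (k : C) q : region_convergent q ->
  region_convergent (fun m n => k * q m n).
Proof.
move=> qc x y xy; have := abs_boundedZ k (qc _ _ xy).
by apply: (@abs_bounded_le _ 1) => // m n; rewrite mul1r /monomials !mulrA.
Qed.

Lemma region_convergentD q q' : region_convergent q -> region_convergent q' ->
  region_convergent (fun m n => q m n + q' m n).
Proof.
move=> qc qc' x y xy; have := abs_boundedD (qc _ _ xy) (qc' _ _ xy).
by apply: (@abs_bounded_le _ 1) => // m n; rewrite mul1r /monomials !mulrDl.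
Qed.

Lemma power_seriesZ (k : C) q x y : region_convergent q -> appell4_region x y ->
  power_series (fun m n => k * q m n) x y = k * power_series q x y.
Proof.
move=> qc xy; rewrite /power_series -(double_sumZ k (qc _ _ xy)).
by apply: eq_double_sum => m n; rewrite /monomials !mulrA.
Qed.

Lemma power_series0 q x y : (forall m n, q m n = 0) -> power_series q x y = 0.
Proof.
move=> q0; apply: cvg_double_sum.
rewrite (_ : square_sum _ = fun=> 0); first exact: cvg_cst.
apply/funext => N; rewrite /square_sum big1 // => m _; rewrite big1 // => n _.
by rewrite /monomials q0 !mul0r.
Qed.

Lemma power_seriesD q q' x y :
  region_convergent q -> region_convergent q' -> appell4_region x y ->
  power_series (fun m n => q m n + q' m n) x y =
  power_series q x y + power_series q' x y.
Proof.
move=> qc qc' xy; rewrite /power_series -(double_sumD (qc _ _ xy) (qc' _ _ xy)).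
by apply: eq_double_sum => m n; rewrite /monomials !mulrDl.
Qed.

(** The Taylor estimate of the monomials, summed over a square and passed to the
    limit. The derived series enters in its lagged form, whose terms m x^(m-1) carry
    the same index m as those of the two other series. *)
Lemma power_series_increment q x y : region_convergent q -> appell4_region x y ->
  exists2 d : C, 0 < d & exists K : C, forall h, `|h| <= d ->
    `|power_series q (x + h) y - power_series q x y
      - h * power_series (coef_dx q) x y| <= K * `|h| ^+ 2.
Proof.
move=> qc xy; have [d d0 dxy] := region_enlarge xy.
have [B qB] := qc _ _ dxy.
exists d => //; exists (B / d ^+ 2) => h hd.
have hxy : appell4_region (x + h) y.
  apply: region_le dxy; rewrite [leRHS]ger0_norm ?addr_ge0 ?(ltW d0)//.
  by apply: le_trans (ler_normD _ _) _; rewrite lerD2l.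
have dqb := region_convergent_dx qc xy.
pose u N : C := square_sum (monomials q (x + h) y) N
  - square_sum (monomials q x y) N
  - h * square_sum (lag (monomials (coef_dx q) x y)) N.
have cv : u @ \oo --> double_sum (monomials q (x + h) y)
    - double_sum (monomials q x y)
    - h * double_sum (lag (monomials (coef_dx q) x y)).
  exact: cvgB (cvgB (cvgn_square_sum (qc _ _ hxy)) (cvgn_square_sum (qc _ _ xy)))
    (cvgM (cvg_cst h) (cvgn_square_sum (abs_bounded_lag dqb))).
rewrite /power_series -(double_sum_lag dqb).
apply: (norm_cvgn_le cv) => N; rewrite /u.
rewrite [X in `|X|](_ : _ = square_sum (fun m n =>
  q m n * ((x + h) ^+ m - x ^+ m - h * (m%:R * x ^+ m.-1)) * y ^+ n) N); last first.
  rewrite /square_sum mulr_sumr -!sumrB; apply: eq_bigr => m _.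
  rewrite mulr_sumr -!sumrB; apply: eq_bigr => n _.
  by case: m => [|m]; rewrite /monomials /coef_dx /=; ring.
rewrite mulrAC ler_pdivlMr ?exprn_gt0//.
rewrite [leRHS]mulrC; apply: le_trans (ler_wpM2l _ (qB N)); last exact: exprn_ge0.
apply: le_trans (ler_wpM2r _ (norm_square_sum_le _ _)) _.
  by rewrite exprn_ge0 // ltW.
rewrite mulrC -!square_sumZ; apply: square_sum_le => m n.
have e0 : 0 <= `|x| + d by rewrite addr_ge0 // ltW.
rewrite /monomials !normrM (ger0_norm (exprn_ge0 _ e0)).
have := ler_wpM2l (mulr_ge0 (normr_ge0 (q m n)) (normr_ge0 (y ^+ n)))
  (taylor1_bound x m d0 hd).
by apply: etrans; congr (_ <= _); ring.
Qed.

End DoublePowerSeries.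

(** * Complex derivatives and termwise differentiation *)
Section ComplexDerivative.
Context {R : realType}.
Local Notation C := (Cplx R).
Implicit Types (f g : C -> C) (x l d K : C).

Lemma quadratic_derive1 f x l d K : 0 < d ->
  (forall h, `|h| <= d -> `|f (x + h) - f x - h * l| <= K * `|h| ^+ 2) ->
  derivable f x 1 /\ derive1 f x = l.
Proof.
move=> d0 fl.
have cv : h^-1 *: (f (h + x) - f x) @[h --> (0 : C)^'] --> l.
  apply/cvgrPdist_lt => e e0.
  have K0 : 0 < `|K| + 1 by rewrite ltr_wpDl.
  have eK0 : 0 < e / (`|K| + 1) by rewrite divr_gt0.
  near=> h.
  have h0 : h != 0 by near: h; exact: nbhs_dnbhs_neq.
  have hd : `|h| < d by near: h; exact: dnbhs0_lt.
  have he : `|h| < e / (`|K| + 1) by near: h; exact: dnbhs0_lt.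
  have nh0 : 0 < `|h| by rewrite normr_gt0.
  rewrite -normrN opprB.
  have -> : h^-1 *: (f (h + x) - f x) - l = h^-1 * (f (x + h) - f x - h * l).
    by rewrite mulrBr mulKf // (addrC x h).
  rewrite normrM normfV mulrC ltr_pdivrMr //.
  apply: le_lt_trans (fl _ (ltW hd)) _.
  have KK : K <= `|K| + 1.
    have : 0 <= K * `|h| ^+ 2 by apply: le_trans (fl _ (ltW hd)).
    by rewrite pmulr_lge0 ?exprn_gt0// => K1; rewrite ger0_norm // lerDl.
  apply: (@le_lt_trans _ _ ((`|K| + 1) * `|h| ^+ 2)).
    by rewrite ler_wpM2r ?exprn_ge0.
  by rewrite expr2 mulrA ltr_pM2r // mulrC -ltr_pdivlMr.
split; last exact: cvg_lim cv.
rewrite /derivable; apply: (@cvgP _ _ l).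
move: cv; apply: cvg_trans; apply: near_eq_cvg; near=> h.
by rewrite /= scaler1.
Unshelve. all: by end_near. Qed.

(** Derivatives are local; needed because the closed form of an iterated derivative
    is known only inside the region. *)
Lemma near_eq_derive1 f g x l : (\forall z \near x, f z = g z) ->
  derivable g x 1 -> derive1 g x = l -> derivable f x 1 /\ derive1 f x = l.
Proof.
move=> fg dg <-; split.
  apply: near_eq_derivable dg; move: fg; apply: filterS => z ->; done.
by rewrite !derive1E; apply: near_eq_derive.
Qed.

End ComplexDerivative.

Section PowerSeriesDerivative.
Context {R : realType}.
Local Notation C := (Cplx R).
Implicit Types (q : nat -> nat -> C) (x y : C).

Lemma power_series_derive1 q x y : region_convergent q -> appell4_region x y ->
  derivable (fun z => power_series q z y) x 1 /\
  derive1 (fun z => power_series q z y) x = power_series (coef_dx q) x y.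
Proof.
move=> qc xy; have [d d0 [K qK]] := power_series_increment qc xy.
exact: (@quadratic_derive1 _ (fun z => power_series q z y) _ _ _ _ d0 qK).
Qed.

Lemma near_region x y : appell4_region x y ->
  \forall z \near x, appell4_region z y.
Proof.
move=> xy; have [d d0 dxy] := region_enlarge xy.
have xd : \forall z \near x, `|x - z| < d by exact: (nbhsx_ballx x d d0).
move: xd; apply: filterS => z zd.
apply: region_le dxy; rewrite [leRHS]ger0_norm; last first.
  by rewrite addr_ge0 // ltW.
rewrite -(subrK x z) addrC; apply: le_trans (ler_normD _ _) _.
by rewrite lerD2l ltW // distrC.
Qed.

End PowerSeriesDerivative.

(** * Recurrences for the Appell coefficients *)
Section AppellSeries.
Context {R : realType}.
Local Notation C := (Cplx R).
Implicit Types (a b c t x y : C) (k l m n r : nat).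

Lemma shifted_factorialD a m n :
  shifted_factorial a (m + n) =
  shifted_factorial a m * shifted_factorial (a + m%:R) n.
Proof.
rewrite /shifted_factorial big_split_ord /=; congr (_ * _).
by apply: eq_bigr => i _; rewrite natrD addrA.
Qed.

Lemma shifted_factorial0 a : shifted_factorial a 0 = 1.
Proof. by rewrite /shifted_factorial big_ord0. Qed.

Lemma shifted_factorial1 a : shifted_factorial a 1 = a.
Proof. by rewrite /shifted_factorial big_ord1 addr0. Qed.

Lemma shifted_factorialS a m :
  shifted_factorial a m.+1 = a * shifted_factorial (a + 1) m.
Proof. by rewrite -add1n shifted_factorialD shifted_factorial1. Qed.

Lemma shifted_factorialSr a m :
  shifted_factorial a m.+1 = shifted_factorial a m * (a + m%:R).
Proof. by rewrite -addn1 shifted_factorialD shifted_factorial1. Qed.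

Lemma appell4E a b c1 c2 t1 t2 k1 k2 x y :
  appell4 a b c1 c2 t1 t2 k1 k2 x y =
  power_series (appell4_coef a b c1 c2 t1 t2 k1 k2) x y.
Proof. by []. Qed.

(** The unordered sum is the supremum of all finite sums, among them those over
    squares. *)
Lemma region_convergent_appell4 a b c1 c2 t1 t2 k1 k2 :
  appell4_abs_cvg a b c1 c2 t1 t2 k1 k2 ->
  region_convergent (appell4_coef a b c1 c2 t1 t2 k1 k2).
Proof.
move=> h x y /h; rewrite /summable; set S := esum _ _ => Sfin.
have S0 : (0 <= S)%E by apply: esum_ge0.
exists (((fine S)%:C)%C) => N.
pose t m n := appell4_term a b c1 c2 t1 t2 k1 k2 x y m n.
have tE m n : `|t m n| = ((complex.Re `|t m n|)%:C)%C :> C.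
  by rewrite RRe_real // normr_real.
have re0 m n : 0 <= complex.Re `|t m n|.
  by have := normr_ge0 (t m n); rewrite lecE => /andP[].
rewrite [leLHS](_ : _ =
    ((\sum_(m <- iota 0 N) \sum_(n <- iota 0 N) complex.Re `|t m n|)%:C)%C); last first.
  rewrite (rmorph_sum (real_complex R)) /square_sum /index_iota subn0.
  apply: eq_bigr => m _; rewrite (rmorph_sum (real_complex R)).
  by apply: eq_bigr => n _; rewrite /= -tE.
rewrite lecR -lee_fin fineK ?ge0_fin_numE//.
pose s := [seq (m, n) | m <- iota 0 N, n <- iota 0 N].
have us : uniq s by apply: allpairs_uniq; rewrite ?iota_uniq// => -[? ?] [].
apply: ereal_sup_ubound; exists [set` s].
  by split => //; exact: finite_seq.
rewrite -fsbig_seq // big_allpairs -sumEFin.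
apply: eq_bigr => m _; rewrite -sumEFin; apply: eq_bigr => n _.
by rewrite gee0_abs // lee_fin re0.
Qed.

Lemma appell4_coefC a b c1 c2 t1 t2 k1 k2 m n :
  appell4_coef a b c1 c2 t1 t2 k1 k2 m n =
  appell4_coef a b c2 c1 t2 t1 k2 k1 n m.
Proof.
by rewrite /appell4_coef addnC; congr (_ / _); ring.
Qed.

Lemma appell4C a b c1 c2 t1 t2 k1 k2 x y :
  appell4 a b c1 c2 t1 t2 k1 k2 x y = appell4 a b c2 c1 t2 t1 k2 k1 y x.
Proof.
rewrite /appell4; congr (limn _); apply/funext => N.
rewrite exchange_big /=; apply: eq_bigr => n _; apply: eq_bigr => m _.
by rewrite /appell4_term appell4_coefC mulrAC.
Qed.

Lemma region_convergentC q : region_convergent q ->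
  region_convergent (fun m n => q n m : C).
Proof.
move=> qc x y /regionC/qc[B qB]; exists B => N; apply: le_trans (qB N).
rewrite -square_sum_transpose; apply: square_sum_le => m n.
by rewrite /monomials mulrAC.
Qed.

Lemma region_convergent_appell4C a b c1 c2 t1 t2 k1 k2 :
  region_convergent (appell4_coef a b c1 c2 t1 t2 k1 k2) ->
  region_convergent (appell4_coef a b c2 c1 t2 t1 k2 k1).
Proof.
move=> /region_convergentC; congr region_convergent.
by apply/funext => m; apply/funext => n; rewrite appell4_coefC.
Qed.

Definition dx_factor a b c t k : C :=
  (-1) ^+ k * a * b * shifted_factorial (- t) k / c.

(** The factor m+1 of the derivative cancels against (m+1)!, and every shifted
    factorial of index increased by 1 (or by k1) splits off its first factors, which
    are collected in dx_factor. *)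
Lemma coef_dx_appell4 a b c1 c2 t1 t2 k1 k2 m n :
  coef_dx (appell4_coef a b c1 c2 t1 t2 k1 k2) m n =
  dx_factor a b c1 t1 k1 *
  appell4_coef (a + 1) (b + 1) (c1 + 1) c2 (t1 - k1%:R) t2 k1 k2 m n.
Proof.
rewrite /coef_dx /appell4_coef /dx_factor addSn !shifted_factorialS factS.
rewrite mulSn exprD (shifted_factorialD (- t1)) opprB [k1%:R - t1]addrC.
rewrite natrM !invfM.
have m0 : m.+1%:R != 0 :> C by rewrite pnatr_eq0.
(* The two sides differ by the factor (m+1) / (m+1), which ring does not cancel. *)
rewrite -[RHS]mulr1 -[X in _ = _ * X](mulfV m0); ring.
Qed.

Definition diff_factor a b c : C := a * b / c.

(** The shifted factorials (-t1-1)_(m+1) and (-t1)_(m+1) share the factor (-t1)_m;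
    their other factors -t1-1 and -t1+m differ by m+1, which cancels against
    (m+1)!. *)
Lemma appell4_coef_diff a b c1 c2 t1 t2 k2 m n :
  appell4_coef a b c1 c2 (t1 + 1) t2 1 k2 m n =
  appell4_coef a b c1 c2 t1 t2 1 k2 m n +
  diff_factor a b c1 *
    lag (appell4_coef (a + 1) (b + 1) (c1 + 1) c2 t1 t2 1 k2) m n.
Proof.
case: m => [|m]; first by rewrite /= mulr0 addr0 /appell4_coef mul0n !shifted_factorial0.
rewrite /= /appell4_coef /diff_factor addSn.
rewrite (shifted_factorialS a) (shifted_factorialS b) (shifted_factorialS c1).
rewrite !muln1 exprS (shifted_factorialS (- (t1 + 1))) opprD addrNK.
rewrite (shifted_factorialSr (- t1)) factS natrM !invfM.
have m0 : m.+1%:R != 0 :> C by rewrite pnatr_eq0.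
rewrite (_ : - t1 - 1 = - t1 + m%:R - m.+1%:R); last by rewrite -natr1; ring.
rewrite -[X in _ = _ + X]mulr1 -[X in _ = _ + _ * X](mulfV m0); ring.
Qed.

(** Raising a parameter by 1 replaces the first factor of its shifted factorial by
    a new last one. *)
Lemma appell4_coef_weight a b c1 c2 t1 t2 k1 k2 m n :
  a != 0 -> b != 0 -> c1 != 0 ->
  appell4_coef (a + 1) (b + 1) (c1 + 1) c2 t1 t2 k1 k2 m n =
  (a * b)^-1 * ((a + (m + n)%:R) * ((b + (m + n)%:R) * (c1 / (c1 + m%:R) *
     appell4_coef a b c1 c2 t1 t2 k1 k2 m n))).
Proof.
move=> a0 b0 c0.
have sa l : shifted_factorial (a + 1) l = a^-1 * (shifted_factorial a l * (a + l%:R)).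
  by rewrite -shifted_factorialSr shifted_factorialS mulKf.
have sb l : shifted_factorial (b + 1) l = b^-1 * (shifted_factorial b l * (b + l%:R)).
  by rewrite -shifted_factorialSr shifted_factorialS mulKf.
have sc l : shifted_factorial (c1 + 1) l = c1^-1 * (shifted_factorial c1 l * (c1 + l%:R)).
  by rewrite -shifted_factorialSr shifted_factorialS mulKf.
by rewrite /appell4_coef sa sb sc !invfM invrK; ring.
Qed.

Lemma region_convergent_weighted a b c1 c2 t1 t2 k1 k2 :
  a != 0 -> b != 0 -> (forall n, c1 + n%:R != 0) ->
  region_convergent (appell4_coef a b c1 c2 t1 t2 k1 k2) ->
  region_convergent (appell4_coef (a + 1) (b + 1) (c1 + 1) c2 t1 t2 k1 k2).
Proof.
move=> a0 b0 c0 qc.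
have c10 : c1 != 0 by rewrite -(addr0 c1) (c0 0%N).
rewrite (_ : appell4_coef (a + 1) _ _ _ _ _ _ _ = fun m n => (a * b)^-1 *
  ((a + (m + n)%:R) * ((b + (m + n)%:R) * (c1 / (c1 + m%:R) *
     appell4_coef a b c1 c2 t1 t2 k1 k2 m n)))); last first.
  by apply/funext => m; apply/funext => n; rewrite appell4_coef_weight.
apply: region_convergentZ.
apply: region_convergent_weight; first exact: subexponential_affine.
apply: region_convergent_weight; first exact: subexponential_affine.
by apply: region_convergent_weight; first exact: subexponential_ratio.
Qed.

End AppellSeries.

(** * Differences and derivatives of the Appell function *)
Section AppellFormulas.
Context {R : realType}.
Local Notation C := (Cplx R).
Implicit Types (a b c t x y : C) (k l m n r : nat).

(** An r-fold difference at t only looks at t, t + 1, ..., t + r; the Appell function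
    is controlled at these points, not at all values of its argument. *)
Lemma eq_iter_forward_diff (f g : C -> C) r t :
  (forall j : nat, (j <= r)%N -> f (t + j%:R) = g (t + j%:R)) ->
  iter r forward_diff f t = iter r forward_diff g t.
Proof.
elim: r f g t => [|r IH] f g t fg; first by have := fg 0%N isT; rewrite addr0.
rewrite !iterSr; apply: IH => j jr; rewrite /forward_diff -addrA natr1.
by rewrite !fg // ltnW.
Qed.

Lemma iter_forward_diffZ (k : C) (f : C -> C) r t :
  iter r forward_diff (fun u => k * f u) t = k * iter r forward_diff f t.
Proof.
elim: r t => [//|r IH] t.
by rewrite !iterS /forward_diff !IH mulrBr.
Qed.

(** Besides the formula this moves convergence from t1 to t1 + 1, which is what an
    iterated difference needs. The series on the right need not converge when a or b
    is 0; then the coefficients do not depend on t1 and both sides vanish. *)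
Lemma appell4_forward_diff a b c1 c2 t1 t2 k2 x y :
  (forall n, c1 + n%:R != 0) -> appell4_region x y ->
  region_convergent (appell4_coef a b c1 c2 t1 t2 1 k2) ->
  region_convergent (appell4_coef a b c1 c2 (t1 + 1) t2 1 k2) /\
  appell4 a b c1 c2 (t1 + 1) t2 1 k2 x y - appell4 a b c1 c2 t1 t2 1 k2 x y =
  diff_factor a b c1 * x *
    appell4 (a + 1) (b + 1) (c1 + 1) c2 t1 t2 1 k2 x y.
Proof.
move=> c0 xy qc.
pose q' := appell4_coef (a + 1) (b + 1) (c1 + 1) c2 t1 t2 1 k2.
have coefE : appell4_coef a b c1 c2 (t1 + 1) t2 1 k2 =
    fun m n => appell4_coef a b c1 c2 t1 t2 1 k2 m n + diff_factor a b c1 * lag q' m n.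
  by apply/funext => m; apply/funext => n; rewrite appell4_coef_diff.
have [ab0|] := eqVneq (diff_factor a b c1) 0.
  have -> : appell4_coef a b c1 c2 (t1 + 1) t2 1 k2 = appell4_coef a b c1 c2 t1 t2 1 k2.
    by rewrite coefE; apply/funext => m; apply/funext => n; rewrite ab0 mul0r addr0.
  rewrite !appell4E ab0 !mul0r; split => //.
  rewrite coefE; apply/eqP; rewrite subr_eq0; apply/eqP.
  by apply: eq_double_sum => m n; rewrite /monomials ab0 mul0r addr0.
rewrite /diff_factor !mulf_eq0 !negb_or => /andP[/andP[a0 b0] _].
have q'c : region_convergent q' by exact: region_convergent_weighted.
have lc := region_convergentZ (diff_factor a b c1) (region_convergent_lag q'c).
split; first by rewrite coefE; exact: region_convergentD.
rewrite !appell4E coefE power_seriesD // addrC addKr.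
rewrite power_seriesZ //; last exact: region_convergent_lag.
by rewrite power_series_lag // mulrA.
Qed.

Lemma shift_neq0 c : (forall n, c + n%:R != 0) -> forall n, c + 1 + n%:R != 0.
Proof. by move=> c0 n; rewrite -addrA nat1r. Qed.

(** The innermost difference is taken first, so that the induction hypothesis applies
    to the parameters a+1, b+1, c1+1. *)
Lemma iter_forward_diff_appell4 a b c1 c2 t1 t2 k2 r x y :
  (forall n, c1 + n%:R != 0) -> appell4_region x y ->
  region_convergent (appell4_coef a b c1 c2 t1 t2 1 k2) ->
  iter r forward_diff (fun t => appell4 a b c1 c2 t t2 1 k2 x y) t1 =
  shifted_factorial a r * shifted_factorial b r * x ^+ r
    / shifted_factorial c1 r *
  appell4 (a + r%:R) (b + r%:R) (c1 + r%:R) c2 t1 t2 1 k2 x y.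
Proof.
elim: r a b c1 => [|r IH] a b c1 c0 xy qc.
  by rewrite !shifted_factorial0 !addr0 expr0 invr1 !mul1r.
rewrite iterSr.
rewrite (@eq_iter_forward_diff _ (fun t => diff_factor a b c1 * x *
    appell4 (a + 1) (b + 1) (c1 + 1) c2 t t2 1 k2 x y)); last first.
  move=> j _; have qj : region_convergent (appell4_coef a b c1 c2 (t1 + j%:R) t2 1 k2).
    elim: j => [|j IHj]; first by rewrite addr0.
    by rewrite -natr1 addrA; have [] := appell4_forward_diff c0 xy IHj.
  by have [_ <-] := appell4_forward_diff c0 xy qj.
rewrite iter_forward_diffZ !shifted_factorialS exprS invfM -natr1 [r%:R + 1]addrC !addrA.
have [ab0|] := eqVneq (diff_factor a b c1) 0.
  rewrite ab0 !mul0r; symmetry; move: ab0; rewrite /diff_factor => /eqP.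
  by rewrite !mulf_eq0 => /orP[/orP[]|] /eqP ->; rewrite !(mul0r, mulr0).
move=> ab0; have /andP[a0 b0] : (a != 0) && (b != 0).
  by move: ab0; rewrite /diff_factor !mulf_eq0 !negb_or => /andP[].
rewrite IH //; [|exact: shift_neq0|exact: region_convergent_weighted].
by rewrite /diff_factor; ring.
Qed.

Definition dx_factor_n a b c t k r : C :=
  (-1) ^+ (r * k) * shifted_factorial a r * shifted_factorial b r *
    shifted_factorial (- t) (r * k) / shifted_factorial c r.

Lemma dx_factor_nS a b c t k r :
  dx_factor_n a b c t k r.+1 = dx_factor_n a b c t k r *
    dx_factor (a + r%:R) (b + r%:R) (c + r%:R) (t - (r * k)%:R) k.
Proof.
rewrite /dx_factor_n /dx_factor !shifted_factorialSr mulSn addnC exprD.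
by rewrite (shifted_factorialD (- t)) opprB [(r * k)%:R - t]addrC invfM; ring.
Qed.

(** The formula for the r-th derivative is proved together with the convergence of
    the series in it. That convergence is claimed only for a nonzero scalar: as soon
    as the scalar is 0, the r-th derivative vanishes identically near x and the
    induction continues without it. *)
Lemma appell4_derive1n a b c1 c2 t1 t2 k1 k2 y r :
  region_convergent (appell4_coef a b c1 c2 t1 t2 k1 k2) ->
  (dx_factor_n a b c1 t1 k1 r != 0 ->
    region_convergent (appell4_coef (a + r%:R) (b + r%:R) (c1 + r%:R) c2
      (t1 - (r * k1)%:R) t2 k1 k2)) /\
  (forall x : C, appell4_region x y ->
    derivable_n r (fun z => appell4 a b c1 c2 t1 t2 k1 k2 z y) x /\
    derive1n r (fun z => appell4 a b c1 c2 t1 t2 k1 k2 z y) x =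
      dx_factor_n a b c1 t1 k1 r *
      appell4 (a + r%:R) (b + r%:R) (c1 + r%:R) c2
        (t1 - (r * k1)%:R) t2 k1 k2 x y).
Proof.
move=> qc; set F := fun z => appell4 _ _ _ _ _ _ _ _ z _.
elim: r => [|r [IHc IHd]].
  rewrite mul0n subr0 !addr0; split => // x xy; split => //.
  by rewrite /dx_factor_n mul0n !shifted_factorial0 expr0 invr1 !mul1r.
set q := appell4_coef (a + r%:R) _ _ _ _ _ _ _ in IHc IHd.
set q' := appell4_coef (a + r.+1%:R) _ _ _ _ _ _ _.
pose e := dx_factor (a + r%:R) (b + r%:R) (c1 + r%:R) (t1 - (r * k1)%:R) k1.
have qE m n : coef_dx q m n = e * q' m n.
  by rewrite /q coef_dx_appell4 /q' -!natr1 !addrA mulSn natrD [k1%:R + _]addrC opprD addrA.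
rewrite dx_factor_nS -/e; set K := dx_factor_n _ _ _ _ _ _ in IHc IHd *.
have q'c : K * e != 0 -> region_convergent q'.
  rewrite mulf_eq0 negb_or => /andP[K0 e0].
  rewrite (_ : q' = fun m n => e^-1 * coef_dx q m n); last first.
    by apply/funext => m; apply/funext => n; rewrite qE mulKf.
  by apply: region_convergentZ; apply: region_convergent_dx; exact: IHc.
split; [exact: q'c | move=> x xy].
suff [dF d1F] : derivable (derive1n r F) x 1 /\
    derive1 (derive1n r F) x = K * e * power_series q' x y.
  split; last exact: d1F.
  move=> j; rewrite ltnS leq_eqVlt => /predU1P[-> //|jr].
  by have [h _] := IHd x xy; exact: h.
have nF : \forall z \near x, derive1n r F z = K * power_series q z y.
  by move: (near_region xy); apply: filterS => z zy; have [] := IHd z zy.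
(* For K = 0 the series with coefficients q may diverge: only the fact that the
   r-th derivative is locally 0 is used. *)
have [K0|K0] := eqVneq K 0.
  apply: (near_eq_derive1 (g := fun=> 0)).
  - by move: nF; apply: filterS => z ->; rewrite K0 mul0r.
  - exact: derivable_cst.
  - by rewrite K0 !mul0r derive1_cst.
have qcr := IHc K0.
have [dq d1q] := power_series_derive1 (region_convergentZ K qcr) xy.
apply: near_eq_derive1 dq _.
  move: (near_region xy) nF; apply: filterS2 => z zy ->.
  by rewrite power_seriesZ.
rewrite d1q -mulrA; transitivity (K * power_series (coef_dx q) x y).
  rewrite -power_seriesZ //; last exact: region_convergent_dx.
  by apply: eq_double_sum => m n; rewrite /monomials /coef_dx [in RHS]mulrCA.
congr (_ * _); have [e0|e0] := eqVneq e 0.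
  by rewrite e0 mul0r power_series0 // => m n; rewrite qE e0 mul0r.
rewrite -power_seriesZ //; last by apply: q'c; rewrite mulf_neq0.
by apply: eq_double_sum => m n; rewrite /monomials qE.
Qed.

Lemma theta_pow_appell4 (a b c1 c2 t1 t2 : C) (k1 k2 r : nat) (x y : C) :
  appell4_region x y ->
  region_convergent (appell4_coef a b c1 c2 t1 t2 k1 k2) ->
  derivable_n r (fun z => appell4 a b c1 c2 t1 t2 k1 k2 z y) x /\
  theta_pow r (fun z => appell4 a b c1 c2 t1 t2 k1 k2 z y) x =
    (-1) ^+ (r * k1) * shifted_factorial a r * shifted_factorial b r *
      shifted_factorial (- t1) (r * k1) * x ^+ r
      / shifted_factorial c1 r *
    appell4 (a + r%:R) (b + r%:R) (c1 + r%:R) c2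
      (t1 - (r * k1)%:R) t2 k1 k2 x y.
Proof.
move=> xy qc; have [_ /(_ _ xy)[dF dFE]] := appell4_derive1n y r qc.
split=> //; rewrite /theta_pow dFE appell4E mulrA; congr (_ * _).
by rewrite /dx_factor_n; ring.
Qed.

End AppellFormulas.

Theorem theorem3p1 (R : realType) (a b c1 c2 t1 t2 : Cplx R)
    (k1 k2 r : nat) (x y : Cplx R)
    (hc1 : forall n : nat, 'Re c1 != - n%:R)
    (hc2 : forall n : nat, 'Re c2 != - n%:R)
    (hr : (1 <= r)%N)
    (hxy : appell4_region x y) :
  [/\ appell4_abs_cvg a b c1 c2 t1 t2 1%N k2 ->
      iter r forward_diff (fun t => appell4 a b c1 c2 t t2 1%N k2 x y) t1 =
        shifted_factorial a r * shifted_factorial b r * x ^+ r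
          / shifted_factorial c1 r *
        appell4 (a + r%:R) (b + r%:R) (c1 + r%:R) c2 t1 t2 1%N k2 x y,
      appell4_abs_cvg a b c1 c2 t1 t2 k1 1%N ->
      iter r forward_diff (fun t => appell4 a b c1 c2 t1 t k1 1%N x y) t2 =
        shifted_factorial a r * shifted_factorial b r * y ^+ r
          / shifted_factorial c2 r *
        appell4 (a + r%:R) (b + r%:R) c1 (c2 + r%:R) t1 t2 k1 1%N x y,
      appell4_abs_cvg a b c1 c2 t1 t2 k1 k2 ->
      derivable_n r (fun z => appell4 a b c1 c2 t1 t2 k1 k2 z y) x /\
      theta_pow r (fun z => appell4 a b c1 c2 t1 t2 k1 k2 z y) x =
        (-1) ^+ (r * k1) * shifted_factorial a r * shifted_factorial b r *
          shifted_factorial (- t1) (r * k1) * x ^+ r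
          / shifted_factorial c1 r *
        appell4 (a + r%:R) (b + r%:R) (c1 + r%:R) c2
          (t1 - (r * k1)%:R) t2 k1 k2 x y
    & appell4_abs_cvg a b c1 c2 t1 t2 k1 k2 ->
      derivable_n r (fun z => appell4 a b c1 c2 t1 t2 k1 k2 x z) y /\
      theta_pow r (fun z => appell4 a b c1 c2 t1 t2 k1 k2 x z) y =
        (-1) ^+ (r * k2) * shifted_factorial a r * shifted_factorial b r *
          shifted_factorial (- t2) (r * k2) * y ^+ r
          / shifted_factorial c2 r *
        appell4 (a + r%:R) (b + r%:R) c1 (c2 + r%:R)
          t1 (t2 - (r * k2)%:R) k1 k2 x y].
Proof.
have neq0 (c : Cplx R) : (forall n : nat, 'Re c != - n%:R) ->
    forall n : nat, c + n%:R != 0.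
  move=> hc n; apply: contra (hc n); rewrite addr_eq0 => /eqP ->.
  by rewrite raddfN /=; have /Creal_ReP -> := realn (Cplx R) n.
have yx := regionC hxy.
split.
- move=> /region_convergent_appell4.
  exact: iter_forward_diff_appell4 (neq0 _ hc1) hxy.
- move=> /region_convergent_appell4/region_convergent_appell4C qc.
  (* The formulas in t2 and y are those in t1 and x for the series with its two
     indices exchanged. *)
  pose f t := appell4 a b c2 c1 t t1 1 k1 y x.
  have -> : (fun t => appell4 a b c1 c2 t1 t k1 1 x y) = f.
    by apply/funext => t; exact: appell4C.
  rewrite [appell4 _ _ c1 _ _ _ _ _ _ _]appell4C.
  exact: iter_forward_diff_appell4 (neq0 _ hc2) yx qc.
- by move=> /region_convergent_appell4; exact: theta_pow_appell4.
- move=> /region_convergent_appell4/region_convergent_appell4C qc.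
  pose f z := appell4 a b c2 c1 t2 t1 k2 k1 z x.
  have fE : f = fun z => appell4 a b c1 c2 t1 t2 k1 k2 x z.
    by apply/funext => z; exact: appell4C.
  rewrite [appell4 _ _ c1 _ _ _ _ _ _ _]appell4C -fE.
  exact: theta_pow_appell4 yx qc.
Qed.
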